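(* Let $q$ be a power of a prime $p$, and let $f(x)=\sum_{n\geq 0}a_nx^n\in x\mathbb{F}_q[[x]]$ (so $f(0)=0$) be algebraic over $\mathbb{F}_q(x)$, of degree $d$ and height $h$. Let $P(x,y)\in\mathbb{F}_q[x,y]$ be the minimal polynomial of $f$. If $\frac{\partial P}{\partial y}(0,0)\neq 0$, then $$\mathrm{comp}_q(\mathbf{a})\leq 1+q^{(h+1)d},$$ where $\mathbf{a}=(a_n)_{n\geq 0}$.
   Context: The degree of $f$ is $[\mathbb{F}_q(x)(f):\mathbb{F}_q(x)]$; the height of $f$ is the minimal degree in $x$ of a nonzero polynomial $P(x,y)\in\mathbb{F}_q[x,y]$ with $P(x,f(x))=0$. The minimal polynomial of $f$ is an irreducible polynomial $P(x,y)\in\mathbb{F}_q[x,y]$ with $P(x,f(x))=0$ (of degree $d$ in $y$ and degree $h$ in $x$). For a $q$-automatic sequence $\mathbf{a}$, $\mathrm{comp}_q(\mathbf{a})$ denotes the number of states of a minimal deterministic finite automaton with output which, given the base-$q$ expansion of $n$ read starting from the least significant digit, outputs $a_n$; equivalently, it equals the cardinality of the $q$-kernel $\{(a_{q^rn+j})_{n\geq 0} : r\geq 0,\ 0\leq j<q^r\}$. *)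

(* Defs.v *)
From HB Require Import structures.
From mathcomp Require Import all_boot all_order all_algebra.
From mathcomp Require Import boolp.

Set Implicit Arguments.
Unset Strict Implicit.
Unset Printing Implicit Defensive.

Import GRing.Theory.
Local Open Scope ring_scope.
Local Open Scope quotient_scope.

(* A wrapper around nat -> R: the bare function type could pick up a pointwise
   multiplication instead of the Cauchy product. *)
Record fps (R : Type) : Type := Fps { fps_coef : nat -> R }.

Section FpsZmodule.
Variable R : comNzRingType.
Implicit Types f g h : fps R.

Lemma fpsP f g : (forall n, fps_coef f n = fps_coef g n) -> f = g.
Proof. by case: f g => [f] [g] /= /funext ->. Qed.

HB.instance Definition _ := gen_eqMixin (fps R).
HB.instance Definition _ := gen_choiceMixin (fps R).

Definition fps_zero : fps R := Fps (fun=> 0).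
Definition fps_opp f : fps R := Fps (fun n => - fps_coef f n).
Definition fps_add f g : fps R := Fps (fun n => fps_coef f n + fps_coef g n).
Definition fps_one : fps R := Fps (fun n => (n == 0%N)%:R).
Definition fps_mul f g : fps R :=
  Fps (fun n => \sum_(i < n.+1) fps_coef f i * fps_coef g (n - i)).

Lemma fps_addA : associative fps_add.
Proof. by move=> f g h; apply: fpsP => n /=; rewrite addrA. Qed.
Lemma fps_addC : commutative fps_add.
Proof. by move=> f g; apply: fpsP => n /=; rewrite addrC. Qed.
Lemma fps_add0 : left_id fps_zero fps_add.
Proof. by move=> f; apply: fpsP => n /=; rewrite add0r. Qed.
Lemma fps_addN : left_inverse fps_zero fps_opp fps_add.
Proof. by move=> f; apply: fpsP => n /=; rewrite addNr. Qed.

HB.instance Definition _ :=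
  GRing.isZmodule.Build (fps R) fps_addA fps_addC fps_add0 fps_addN.

Definition fps_trunc m f : {poly R} := \poly_(i < m) fps_coef f i.

Lemma fps_mul_trunc m f g n : (n < m)%N ->
  fps_coef (fps_mul f g) n = (fps_trunc m f * fps_trunc m g)`_n.
Proof.
move=> nm; rewrite coefM /=; apply: eq_bigr => i _.
rewrite !coef_poly (leq_ltn_trans (leq_subr _ _) nm).
by rewrite (leq_trans (ltn_ord i) nm).
Qed.

Lemma fps_mulC : commutative fps_mul.
Proof.
by move=> f g; apply: fpsP => n; rewrite !(@fps_mul_trunc n.+1) // mulrC.
Qed.

Lemma fps_mulA : associative fps_mul.
Proof.
move=> f g h; apply: fpsP => n.
have -> : fps_coef (fps_mul f (fps_mul g h)) n
    = (fps_trunc n.+1 f * (fps_trunc n.+1 g * fps_trunc n.+1 h))`_n.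
  rewrite coefM; apply: eq_bigr => i _; rewrite coef_poly ltn_ord.
  by rewrite (@fps_mul_trunc n.+1) // ltnS leq_subr.
have -> : fps_coef (fps_mul (fps_mul f g) h) n
    = ((fps_trunc n.+1 f * fps_trunc n.+1 g) * fps_trunc n.+1 h)`_n.
  rewrite coefM; apply: eq_bigr => i _.
  by rewrite (@fps_mul_trunc n.+1) // coef_poly ltnS leq_subr.
by rewrite mulrA.
Qed.

Lemma fps_mul1 : left_id fps_one fps_mul.
Proof.
move=> f; apply: fpsP => n /=.
rewrite big_ord_recl /= mul1r subn0 big1 ?addr0 // => i _.
by rewrite mul0r.
Qed.

Lemma fps_mulDl : left_distributive fps_mul fps_add.
Proof.
move=> f g h; apply: fpsP => n /=.
by rewrite -big_split /=; apply: eq_bigr => i _; rewrite mulrDl.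
Qed.

Lemma fps_one_neq0 : fps_one != 0.
Proof.
by apply/eqP => /(congr1 (fun f => fps_coef f 0%N)) /eqP; rewrite oner_eq0.
Qed.

HB.instance Definition _ := GRing.Zmodule_isComNzRing.Build (fps R)
  fps_mulA fps_mulC fps_mul1 fps_mulDl fps_one_neq0.

Definition fps_of_poly (u : {poly R}) : fps R := Fps (fun n => u`_n).

Lemma fps_of_poly_is_zmod : zmod_morphism fps_of_poly.
Proof. by move=> u v; apply: fpsP => n /=; rewrite coefB. Qed.
Lemma fps_of_poly_is_monoid : monoid_morphism fps_of_poly.
Proof.
split=> [|u v]; apply: fpsP => n /=; first by rewrite coef1.
by rewrite coefM.
Qed.
HB.instance Definition _ := GRing.isZmodMorphism.Build {poly R} (fps R)
  fps_of_poly fps_of_poly_is_zmod.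
HB.instance Definition _ := GRing.isMonoidMorphism.Build {poly R} (fps R)
  fps_of_poly fps_of_poly_is_monoid.

Lemma fps_of_poly_inj : injective fps_of_poly.
Proof.
move=> u v uv; apply/polyP => n.
exact: (congr1 (fun f => fps_coef f n) uv).
Qed.

(* Invertibility is decided and the inverse chosen classically. *)
Definition fps_unit : pred (fps R) := fun f => `[< exists g, g * f = 1 >].
Definition fps_inv f : fps R :=
  if pselect (exists g, g * f = 1) is left ex then sval (cid ex) else f.

Lemma fps_mulVf : {in fps_unit, left_inverse 1 fps_inv *%R}.
Proof.
move=> f /asboolP fU; rewrite /fps_inv.
by case: pselect => // ex; case: cid.
Qed.
Lemma fps_unitP f g : g * f = 1 -> fps_unit f.
Proof. by move=> gf; apply/asboolP; exists g. Qed.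
Lemma fps_inv_out : {in [predC fps_unit], fps_inv =1 id}.
Proof.
move=> f /asboolP fU; rewrite /fps_inv.
by case: pselect => // ex; case: fU.
Qed.

HB.instance Definition _ := GRing.ComNzRing_hasMulInverse.Build (fps R)
  fps_mulVf fps_unitP fps_inv_out.

End FpsZmodule.

Section FpsIdomain.
Variable R : idomainType.

Lemma fps_order (f : fps R) : f != 0 ->
  exists2 m, fps_coef f m != 0 & forall i, (i < m)%N -> fps_coef f i = 0.
Proof.
move=> f0; have ex : exists n, fps_coef f n != 0.
  apply: contrapT => nex; case/eqP: f0; apply: fpsP => n.
  by apply/eqP; apply: contrapT => /negP fn; apply: nex; exists n.
case: (ex_minnP ex) => m fm min; exists m => // i im.
by apply/eqP; apply: contraTT im => /min; rewrite -leqNgt.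
Qed.

Lemma fps_idomain : GRing.integral_domain_axiom (fps R).
Proof.
move=> f g fg; apply: contrapT => /negP; rewrite negb_or => /andP[].
move=> /fps_order[m fm fmin] /fps_order[n gn gmin].
have: fps_coef (f * g) (m + n) = 0 by rewrite fg.
rewrite /= (bigD1 (inord m)) //= inordK ?ltnS ?leq_addr // addKn.
rewrite big1 ?addr0 => [/eqP|i /eqP im].
  by rewrite mulf_eq0 (negPf fm) (negPf gn).
have [lt|gt|e] := ltngtP i m; last by case: im; apply: val_inj; rewrite /= inordK ?ltnS ?leq_addr.
  by rewrite fmin // mul0r.
by rewrite gmin ?mulr0 // ltn_subLR ?ltn_add2r // -ltnS.
Qed.

HB.instance Definition _ :=
  GRing.ComUnitRing_isIntegral.Build (fps R) fps_idomain.

End FpsIdomain.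

Local Notation "x %:F" := (FracField.tofrac x).

Notation ratfun F := {fraction {poly F}}.
Notation laurent F := {fraction (fps F)}.

Section Algebraic.
Variable F : fieldType.

Definition ratfun_laurent (z : ratfun F) : laurent F :=
  (fps_of_poly \n_(repr z))%:F / (fps_of_poly \d_(repr z))%:F.

Lemma fracE (R : idomainType) (z : {fraction R}) :
  z = (\n_(repr z))%:F / (\d_(repr z))%:F.
Proof.
have d0 : (\d_(repr z))%:F != 0 :> {fraction R} by rewrite tofrac_eq0 denom_ratioP.
apply/(canRL (mulfK d0)); rewrite -{1}[z]reprK; unlock FracField.tofrac.
rewrite -[LHS]FracField.pi_mul; apply/eqmodP.
rewrite /= FracField.equivfE /FracField.mulf.
by rewrite !numden_Ratio ?mulr1 ?oner_eq0 ?denom_ratioP // mulrC.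
Qed.

Lemma laurent_den_neq0 (v : {poly F}) :
  v != 0 -> (fps_of_poly v)%:F != 0 :> laurent F.
Proof.
move=> v0; rewrite tofrac_eq0 -(raddf0 (@fps_of_poly F)).
by rewrite (inj_eq (@fps_of_poly_inj F)).
Qed.

Lemma ratfun_laurentE (u v : {poly F}) : v != 0 ->
  ratfun_laurent (u%:F / v%:F) = (fps_of_poly u)%:F / (fps_of_poly v)%:F.
Proof.
move=> v0; rewrite /ratfun_laurent.
have d0 := denom_ratioP (repr (u%:F / v%:F : ratfun F)).
apply/eqP; rewrite eqr_div ?laurent_den_neq0 //.
rewrite -!rmorphM tofrac_eq (inj_eq (@fps_of_poly_inj F)).
rewrite -tofrac_eq !rmorphM -eqr_div ?tofrac_eq0 //.
by rewrite -fracE.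
Qed.

Lemma ratfun_laurent_is_zmod : zmod_morphism ratfun_laurent.
Proof.
move=> y z; rewrite [y]fracE [z]fracE.
move: (\n_(repr y)) (\d_(repr y)) (denom_ratioP (repr y)) => u v v0.
move: (\n_(repr z)) (\d_(repr z)) (denom_ratioP (repr z)) => s t t0.
rewrite -mulNr addf_div ?tofrac_eq0 // mulNr -!tofracM -tofracB.
rewrite !ratfun_laurentE ?mulf_neq0 //.
rewrite -[X in _ = _ + X]mulNr addf_div ?laurent_den_neq0 // mulNr.
by rewrite -!tofracM -tofracB -!rmorphM -rmorphB.
Qed.

Lemma ratfun_laurent_is_monoid : monoid_morphism ratfun_laurent.
Proof.
split=> [|y z].
  have -> : 1 = 1%:F / 1%:F :> ratfun F by rewrite tofrac1 divr1.
  by rewrite ratfun_laurentE ?oner_eq0 // !rmorph1 divr1.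
rewrite [y]fracE [z]fracE.
move: (\n_(repr y)) (\d_(repr y)) (denom_ratioP (repr y)) => u v v0.
move: (\n_(repr z)) (\d_(repr z)) (denom_ratioP (repr z)) => s t t0.
rewrite mulf_div -!tofracM !ratfun_laurentE ?mulf_neq0 //.
by rewrite mulf_div -!tofracM -!rmorphM.
Qed.

HB.instance Definition _ := GRing.isZmodMorphism.Build (ratfun F) (laurent F)
  ratfun_laurent ratfun_laurent_is_zmod.
HB.instance Definition _ := GRing.isMonoidMorphism.Build (ratfun F) (laurent F)
  ratfun_laurent ratfun_laurent_is_monoid.

(* The subfield F(x)(f) of F((x)): the intersection of all subfields
   containing F(x) and f. *)
Definition ratfun_adjoin (f : fps F) (z : laurent F) : Prop :=
  forall S : {pred laurent F}, GRing.divring_closed S ->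
    (forall c : ratfun F, ratfun_laurent c \in S) -> f%:F \in S -> z \in S.

(* [F(x)(f) : F(x)] = d, witnessed by a basis with d elements *)
Definition alg_degree (f : fps F) (d : nat) : Prop :=
  exists b : 'I_d -> laurent F,
    [/\ forall i, ratfun_adjoin f (b i),
        forall c : 'I_d -> ratfun F,
          \sum_i ratfun_laurent (c i) * b i = 0 -> forall i, c i = 0
      & forall z, ratfun_adjoin f z ->
          exists c : 'I_d -> ratfun F, z = \sum_i ratfun_laurent (c i) * b i].

(* Bivariate polynomials P(x,y) are {poly {poly F}}: the outer variable is y,
   the inner one is x. *)
Definition fps_eval (P : {poly {poly F}}) (f : fps F) : fps F :=
  (map_poly (@fps_of_poly F) P).[f].

Definition degx (P : {poly {poly F}}) : nat := (sizeY P).-1.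

Definition alg_height (f : fps F) (h : nat) : Prop :=
  (exists P : {poly {poly F}}, [/\ P != 0, fps_eval P f = 0 & degx P = h]) /\
  (forall P : {poly {poly F}}, P != 0 -> fps_eval P f = 0 -> (h <= degx P)%N).

End Algebraic.

(* Irreducibility in the ring R itself: over {poly {poly F}}, irreducible_poly
   would ignore factors lying in F[x]. *)
Definition irreducible_elt (R : idomainType) (P : R) : Prop :=
  [/\ P != 0, P \isn't a GRing.unit &
      forall A B : R, P = A * B -> A \is a GRing.unit \/ B \is a GRing.unit].

Definition minimal_polynomial (F : fieldType) (f : fps F)
    (P : {poly {poly F}}) : Prop :=
  irreducible_elt P /\ fps_eval P f = 0.

Record dfao (q : nat) (A : Type) : Type := Dfao {
  dfao_state : finType;
  dfao_start : dfao_state;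
  dfao_step : dfao_state -> 'I_q -> dfao_state;
  dfao_out : dfao_state -> A
}.

Definition dfao_run (q : nat) (A : Type) (M : dfao q A) (w : seq 'I_q) : A :=
  dfao_out (foldl (@dfao_step q A M) (dfao_start M) w).

(* The integer with base-q digits w, least significant digit first *)
Definition lsd_value (q : nat) (w : seq 'I_q) : nat :=
  foldr (fun (i : 'I_q) n => i + q * n)%N 0%N w.

(* The output must be right on every expansion of n, including those padded
   with zeros in the most significant positions (the last ones read); under this
   convention the minimal number of states is the cardinality of the q-kernel. *)
Definition dfao_generates (q : nat) (A : Type) (M : dfao q A) (a : nat -> A) :
    Prop :=
  forall w : seq 'I_q, dfao_run M w = a (lsd_value w).

Definition is_comp (q : nat) (A : Type) (a : nat -> A) (c : nat) : Prop :=
  (exists2 M : dfao q A, dfao_generates M a & #|dfao_state M| = c) /\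
  (forall M : dfao q A, dfao_generates M a -> (c <= #|dfao_state M|)%N).

(* Main.v *)
Require Import Defs.
From mathcomp Require Import all_boot all_order all_algebra.
From mathcomp Require Import all_field boolp zify ring.

Import GRing.Theory.
Local Open Scope ring_scope.

(* Put e = P_y(x,f), which is nonzero at x = 0, and consider the power series g with
   e g = R(x,f) for some polynomial R of degree at most h in x and at most d in y.
   With q = #|F|, the section operator Lambda_r taking g to the series with
   coefficients g_(qn+r) satisfies Lambda_r (u^q v) = u Lambda_r v, so that
   e Lambda_r g = Lambda_r (e^(q-1) R(x,f)).  Factoring P = (y - f) Q over F[[x]],
   this is Lambda_r (G(f)) for G = R Q^(q-1), and G(f) is the sum over m of f^(qm)
   times the coefficient of y^(qm+q-1) in G (y - f)^(q-1) = R P^(q-1).  Hence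
   e Lambda_r g = S(x,f), where S collects the coefficients of x^(qn+r) y^(qm+q-1) in
   R P^(q-1); it has degree at most h in x and at most d - 1 in y.  These S are the
   q^((h+1)d) states of an automaton, to which f itself, with R = y P_y, is added.
   That P has degree at most d in y and h in x is Gauss's lemma. *)

(** * Section operators on power series and the Frobenius map *)

Definition fps_section {R : Type} (q r : nat) (g : fps R) : fps R :=
  Fps (fun n => fps_coef g (q * n + r)%N).

Definition poly_section {R : nzSemiRingType} (q r N : nat) (u : {poly R}) :
    {poly R} :=
  \poly_(i < N) u`_(q * i + r)%N.

Lemma fps_of_poly_section {R : comNzRingType} (q r N : nat) (u : {poly R}) :
  (size u <= q * N)%N ->
  fps_of_poly (poly_section q r N u) = fps_section q r (fps_of_poly u).
Proof.
move=> su; apply: fpsP => n /=; rewrite coef_poly; case: ltnP => // Nn.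
rewrite nth_default //; apply: leq_trans su (leq_trans _ (leq_addr _ _)).
by rewrite leq_mul2l Nn orbT.
Qed.

Lemma fps_section_sum {R : comNzRingType} (q r : nat) (I : Type) (s : seq I)
    (g : I -> fps R) :
  fps_section q r (\sum_(i <- s) g i) = \sum_(i <- s) fps_section q r (g i).
Proof.
by apply: (big_morph (fps_section q r)) => [u v|]; apply: fpsP.
Qed.

(** Powers of series are reduced to powers of polynomials, for which Frobenius can be expanded as a
    finite sum. *)
Lemma fps_exp_trunc {R : comNzRingType} (m k n : nat) (f : fps R) : (n < m)%N ->
  fps_coef (f ^+ k) n = (fps_trunc m f ^+ k)`_n.
Proof.
elim: k n => [|k IH] n nm; first by rewrite !expr0 coef1.
rewrite !exprS (@fps_mul_trunc _ m) // !coefM.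
apply: eq_bigr => i _; congr (_ * _).
have lt : (n - i < m)%N := leq_ltn_trans (leq_subr _ _) nm.
by rewrite -IH // coef_poly lt.
Qed.

Lemma finField_pnat {F : finFieldType} {p m : nat} :
  prime p -> #|F| = (p ^ m)%N -> [pchar F].-nat #|F|.
Proof.
move=> hp hF; rewrite hF pnatX; apply/orP; left.
by rewrite pnatE // (card_finPcharP hF hp).
Qed.

Lemma finField_poly_exp_card (F : finFieldType) (u : {poly F}) (N : nat) :
  [pchar F].-nat #|F| -> (size u <= N)%N ->
  u ^+ #|F| = \sum_(i < N) u`_i *: 'X^(#|F| * i).
Proof.
move=> Fq su; have {1}-> : u = \sum_(i < N) u`_i *: 'X^i.
  apply/polyP => k; rewrite -poly_def coef_poly; case: ltnP => // Nk.
  by rewrite nth_default // (leq_trans su).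
pose P (v w : {poly F}) := v ^+ #|F| = w.
apply: (big_ind2 P); rewrite /P.
- by rewrite expr0n eqn0Ngt (ltnW (finNzRing_gt1 F)).
- move=> v1 w1 v2 w2 <- <-; rewrite exprDn_pchar //.
  by rewrite (eq_pnat _ (pchar_poly F)).
- by move=> i _; rewrite exprZn expf_card -exprM mulnC.
Qed.

(** Only exponents divisible by q occur in g^q, and q i <= q n + r amounts to i <= n because r <
    q. *)
Lemma fps_section_expM (F : finFieldType) (r : nat) (g u : fps F) :
  [pchar F].-nat #|F| -> (r < #|F|)%N ->
  fps_section #|F| r (g ^+ #|F| * u) = g * fps_section #|F| r u.
Proof.
move=> Fq rq; apply: fpsP => n; set q := #|F|; set m := (q * n + r).+1.
have q0 : (0 < q)%N by apply: leq_ltn_trans rq.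
transitivity ((fps_trunc m g ^+ q * fps_trunc m u)`_(q * n + r)).
  rewrite [LHS](@fps_mul_trunc _ m) // !coefM; apply: eq_bigr => i _.
  by rewrite coef_poly ltn_ord (@fps_exp_trunc _ m).
rewrite (@finField_poly_exp_card _ _ m) ?size_poly // -/q mulr_suml coef_sum /=.
have nm : (n < m)%N by rewrite /m; nia.
rewrite (big_ord_widen m
  (fun i => fps_coef g i * fps_coef u (q * (n - i) + r)%N)) // [RHS]big_mkcond.
apply: eq_bigr => i _; rewrite -scalerAl coefZ ['X^_ * _]mulrC coefMXn.
rewrite coef_poly ltn_ord ltnS; case: (leqP i n) => ni; last by rewrite ifT ?mulr0 //; nia.
rewrite ifF; last by apply/negbTE; rewrite -leqNgt; nia.
rewrite coef_poly ifT; last by rewrite /m; nia.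
by congr (_ * fps_coef u _); nia.
Qed.

(* Writing G = G(c) + (X - c) H, the contribution of (X - c)^q H = (X^q - c^q) H
   telescopes. *)
Lemma horner_section (A : idomainType) (q N : nat) (c : A) (G : {poly A}) :
  (0 < q)%N -> (0 < N)%N -> [pchar A].-nat q -> (size G <= q * N)%N ->
  \sum_(0 <= m < N)
    (G * ('X - c%:P) ^+ q.-1)`_(q * m + q.-1) * c ^+ (q * m) = G.[c].
Proof.
move=> q0 N0 Aq sG.
have [H HE] : exists H, G - (G.[c])%:P = H * ('X - c%:P).
  by apply/factor_theorem; rewrite /root hornerD hornerN hornerC subrr.
have sH : (size H <= (q * N).-1)%N.
  have [->|H0] := eqVneq H 0; first by rewrite size_poly0.
  have := size_polyD G (- (G.[c])%:P).
  rewrite HE size_Mmonic ?monicXsubC // size_XsubC addn2 /= size_polyN.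
  have qN0 : (0 < q * N)%N by rewrite muln_gt0 q0.
  rewrite -[(size H <= _)%N]ltnS (prednK qN0) leq_max.
  case/orP=> /leq_trans -> //.
  exact: leq_trans (size_polyC_leq1 _) qN0.
have Xq : ('X - c%:P) ^+ q = 'X^q - (c ^+ q)%:P.
  have Pq : [pchar {poly A}].-nat q by rewrite (eq_pnat _ (pchar_poly A)).
  apply: (addIr ((c ^+ q)%:P)); rewrite subrK polyC_exp -exprDn_pchar //.
  by rewrite subrK.
have -> : G * ('X - c%:P) ^+ q.-1 =
    (G.[c])%:P * ('X - c%:P) ^+ q.-1 + H * ('X^q - (c ^+ q)%:P).
  by rewrite -Xq -{3}(prednK q0) exprS mulrA -HE -mulrDl [(G.[c])%:P + _]addrC subrK.
(* For m > 0 the index is q m - 1; at m = 0 it would be -1, which [.-1] turns into 0, so the value 0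
   is imposed. *)
pose t m := if m == 0%N then 0 else H`_(q * m).-1 * c ^+ (q * m).
have E m : ((G.[c])%:P * ('X - c%:P) ^+ q.-1
     + H * ('X^q - (c ^+ q)%:P))`_(q * m + q.-1) * c ^+ (q * m) =
    (m == 0%N)%:R * G.[c] - (t m.+1 - t m).
  have -> : t m.+1 = H`_(q * m + q.-1) * c ^+ q * c ^+ (q * m).
    rewrite /t /= -mulrA -exprD mulnS; congr (H`_ _ * _).
    by move: (q * m)%N => a; lia.
  have -> : t m = (H * 'X^q)`_(q * m + q.-1) * c ^+ (q * m).
    rewrite /t coefMXn; case: (eqVneq m 0%N) => [->|m0].
      by rewrite muln0 ifT ?mul0r //; lia.
    rewrite ifF; last by apply/negbTE; rewrite -leqNgt; nia.
    by congr (H`_ _ * _); nia.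
  have -> : (m == 0%N)%:R = (('X - c%:P) ^+ q.-1)`_(q * m + q.-1) * c ^+ (q * m).
    case: (eqVneq m 0%N) => [->|m0].
      rewrite muln0 add0n mulr1.
      have /monicP := monic_exp q.-1 (monicXsubC c).
      by rewrite lead_coefE size_exp_XsubC.
    by rewrite nth_default ?mul0r // size_exp_XsubC; nia.
  by rewrite coefD coefCM mulrBr coefB coefMC; ring.
rewrite (eq_bigr _ (fun m _ => E m)) sumrB telescope_sumr // big_ltn //= mul1r.
rewrite big_nat big1 => [|i /andP[i0 _]]; last by rewrite gtn_eqF ?mul0r.
(* The end term [t N] involves the coefficient of index q N - 1 of [H], which is zero by [sH]. *)
rewrite addr0 {1}/t gtn_eqF // nth_default ?mul0r ?subr0 //.
Qed.

(** * Gauss's lemma for polynomials in y over F[x] *)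

Lemma irreducible_factor {F : fieldType} {c : {poly F}} : (1 < size c)%N ->
  exists2 u, irreducible_poly u & u %| c.
Proof.
have [n] := ubnP (size c); elim: n c => // n IH c sc c1.
have [irr|] := pselect (irreducible_poly c); first by exists c.
move=> nirr.
have [v [v1 vc nvc]] : exists v : {poly F},
    [/\ size v != 1%N, v %| c & ~~ (v %= c)].
  apply: contrapT => nex; apply: nirr; split => // v v1 vc.
  by apply: contrapT => /negP nvc; apply: nex; exists v.
have c0 : c != 0 by rewrite -size_poly_gt0 ltnW.
have v0 : v != 0 by apply: contraTneq vc => ->; rewrite dvd0p.
have [] := IH v; last by move=> u irr uv; exists u => //; apply: dvdp_trans vc.
  have := dvdp_leq c0 vc; rewrite leq_eqVlt dvdp_size_eqp // (negPf nvc) /=.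
  by move=> /leq_trans; apply.
by rewrite ltn_neqAle eq_sym v1 size_poly_gt0.
Qed.

(** If [i] and [j] are the least indices of coefficients of [A] and [B] not divisible by [u], then
    modulo [u] the coefficient of index [i + j] of [A * B] is the product of these two. *)
Lemma irreducible_dvdp_coefM {F : fieldType} {u : {poly F}}
    {A B : {poly {poly F}}} : irreducible_poly u ->
  (forall k, u %| (A * B)`_k) ->
  (forall i, u %| A`_i) \/ (forall i, u %| B`_i).
Proof.
move=> irr uAB; apply: contrapT => /not_orP[/existsNP exA /existsNP exB].
have {}exA : exists i, ~~ (u %| A`_i) by case: exA => i /negP; exists i.
have {}exB : exists i, ~~ (u %| B`_i) by case: exB => i /negP; exists i.
case: (ex_minnP exA) => i Ai mini; case: (ex_minnP exB) => j Bj minj.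
have := uAB (i + j)%N.
have lt : (i < (i + j).+1)%N by rewrite ltnS leq_addr.
rewrite coefM (bigD1 (Ordinal lt)) //= addKn dvdp_addl; last first.
  apply: (big_ind (fun w => u %| w)) => [||k ki]; [exact: dvdp0 | exact: dvdp_add |].
  have [kl|kg|e] := ltngtP k i; last by case/eqP: ki; apply: val_inj.
    by apply: dvdp_mulr; apply: contraTT kl => /mini; rewrite -leqNgt.
  apply: dvdp_mull; apply: contraTT kg => /minj; rewrite -leqNgt.
  by have := ltn_ord k; lia.
rewrite Gauss_dvdpr; first by rewrite (negPf Bj).
by rewrite irreducible_poly_coprime.
Qed.

Lemma polyC_dvd_coef {F : fieldType} {u : {poly F}} {A : {poly {poly F}}} :
  (forall i, u %| A`_i) -> exists B, A = u *: B.
Proof.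
move=> uA; exists (\poly_(i < size A) (A`_i %/ u)); apply/polyP => k.
rewrite coefZ coef_poly; case: ltnP => sk; first by rewrite mulrC divpK.
by rewrite mulr0 nth_default.
Qed.

(* Gauss's lemma without contents: the prime factors of c are cancelled one by one
   against A or B. *)
Lemma gauss_factor {F : fieldType} {c : {poly F}} {A B C : {poly {poly F}}} :
  c != 0 -> c *: C = A * B ->
  exists A' B' v, C = A' * B' /\ B = v *: B'.
Proof.
have [n] := ubnP (size c); elim: n c A B => // n IH c A B sc c0 E.
have [c1|c1] := leqP (size c) 1.
  exists (c^-1 *: A), B, 1; split; rewrite ?scale1r //.
  have cu : c \is a GRing.unit.
    rewrite poly_unitE eqn_leq c1 size_poly_gt0 c0 /= unitfE.
    by move: c0; rewrite -lead_coef_eq0 lead_coefE; case: (size c) c1 => [|[|]].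
  by rewrite -scalerAl -E scalerA mulVr ?scale1r.
have [u irr /dvdpP[c' cE]] := irreducible_factor c1.
have u0 : u != 0 by case: irr => u1 _; rewrite -size_poly_gt0 ltnW.
have c'0 : c' != 0 by apply: contraNneq c0 => c'0; rewrite cE c'0 mul0r.
have sc' : (size c' < n)%N.
  case: irr => u1 _; move: sc; rewrite cE size_mul //; move: u1.
  by move: (size u) (size c') => a b; lia.
have cancel (U V : {poly {poly F}}) : u *: U = u *: V -> U = V.
  move=> UV; apply/polyP => k; apply: (mulfI u0).
  by rewrite -!coefZ UV.
have [] := irreducible_dvdp_coefM (A := A) (B := B) irr.
- by move=> k; rewrite -E coefZ cE mulrAC dvdp_mull.
- move=> /polyC_dvd_coef[A1 A1E].
  have [|A' [B' [v [CE BE]]]] := IH c' A1 B sc' c'0.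
    by apply: cancel; rewrite scalerA mulrC -cE E A1E scalerAl.
  by exists A', B', v; split.
(* A factor taken from [B] is collected in [v]; one taken from [A] leaves no trace, since [A'] need
   not be related to [A]. *)
- move=> /polyC_dvd_coef[B1 B1E].
  have [|A' [B' [v [CE BE]]]] := IH c' A B1 sc' c'0.
    by apply: cancel; rewrite scalerA mulrC -cE E B1E scalerAr.
  by exists A', B', (u * v); split=> //; rewrite B1E BE scalerA.
Qed.

(** * Divisibility by the minimal polynomial *)

Lemma fps_evalM {F : fieldType} (A B : {poly {poly F}}) (f : fps F) :
  fps_eval (A * B) f = fps_eval A f * fps_eval B f.
Proof. by rewrite /fps_eval rmorphM hornerM. Qed.

Lemma fps_evalZ {F : fieldType} (c : {poly F}) (A : {poly {poly F}})
    (f : fps F) : fps_eval (c *: A) f = fps_of_poly c * fps_eval A f.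
Proof. by rewrite /fps_eval map_polyZ hornerZ. Qed.

Lemma fps_of_poly_eq0 {F : fieldType} (c : {poly F}) :
  (fps_of_poly c == 0) = (c == 0).
Proof. by rewrite -(inj_eq (@fps_of_poly_inj F)) rmorph0. Qed.

Lemma fps_eval_unit {F : fieldType} (A : {poly {poly F}}) (f : fps F) :
  A \is a GRing.unit -> fps_eval A f != 0.
Proof.
move=> uA; apply: contraTneq isT => A0; have := oner_neq0 (fps F).
have {1}-> : 1 = fps_eval (A * A^-1) f by rewrite divrr // /fps_eval rmorph1 hornerC.
by rewrite fps_evalM A0 mul0r eqxx.
Qed.

(** Pseudo-division gives divisibility up to a factor in F[x]. Dividing by an annihilator of least
    degree in y shows that [P] has that degree; then [P] is the divisor. Gauss's lemma and the
    irreducibility of [P] remove the factor. *)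
Lemma minimal_polynomial_dvd {F : fieldType} {f : fps F}
    {P A : {poly {poly F}}} :
  minimal_polynomial f P -> fps_eval A f = 0 -> exists B, A = B * P.
Proof.
move=> [[P0 _ irrP] Pf] Af.
pose S n := `[< exists G, [/\ G != 0, fps_eval G f = 0 & size G = n] >].
have exS : exists n, S n by exists (size P); apply/asboolP; exists P.
case: (ex_minnP exS) => n /asboolP[G [G0 Gf Gn]] minn.
(* A nonzero pseudo-remainder would vanish at [f] and be smaller than [V], against the minimality of
   [n]. *)
have divG (U V : {poly {poly F}}) : V != 0 -> fps_eval V f = 0 -> size V = n ->
    fps_eval U f = 0 -> exists2 c, c != 0 & exists W, c *: U = W * V.
  move=> V0 Vf Vn Uf; exists (lead_coef V ^+ scalp U V).
    by rewrite expf_neq0 ?lead_coef_eq0.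
  exists (U %/ V); have E := Pdiv.Idomain.divp_eq U V.
  have [R0|R0] := eqVneq (U %% V) 0; first by rewrite E R0 addr0.
  have : S (size (U %% V)).
    apply/asboolP; exists (U %% V); split=> //.
    rewrite -[U %% V](addrK (U %/ V * V)) [X in X - _]addrC -E.
    rewrite /fps_eval rmorphB hornerD hornerN -!/(fps_eval _ f).
    by rewrite fps_evalZ fps_evalM Uf Vf !mulr0 subr0.
  by move/minn; rewrite leqNgt -Vn Pdiv.Idomain.ltn_modp V0.
have nunit (V : {poly {poly F}}) : fps_eval V f = 0 -> V \isn't a GRing.unit.
  by move=> Vf; apply/negP => /(fps_eval_unit _ f); rewrite Vf eqxx.
have scale_ann v (V : {poly {poly F}}) : v *: V != 0 -> fps_eval (v *: V) f = 0 ->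
    fps_eval V f = 0.
  move=> vV0 /eqP; rewrite fps_evalZ mulf_eq0 fps_of_poly_eq0.
  by case/orP => /eqP // v0; rewrite v0 scale0r eqxx in vV0.
have sP : size P = n.
  have [c c0 [Q cP]] := divG P G G0 Gf Gn Pf.
  have [Q' [G' [v [PE GE]]]] := gauss_factor c0 cP.
  have G'f : fps_eval G' f = 0 by apply: (scale_ann v); rewrite -GE.
  have [uQ|uG] := irrP _ _ PE; last by case/negP: (nunit _ G'f).
  have v0 : v != 0 by apply: contraNneq G0 => v0; rewrite GE v0 scale0r.
  have G'0 : G' != 0 by apply: contraNneq G0 => G'0; rewrite GE G'0 scaler0.
  have Q'0 : Q' != 0 by apply: contraTneq uQ => ->; rewrite unitr0.
  rewrite PE size_mul // -Gn GE size_scale //.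
  by move: uQ; rewrite poly_unitE => /andP[/eqP-> _].
have [c c0 [Q cA]] := divG A P P0 Pf sP Af.
have [Q' [P' [v [AE PE]]]] := gauss_factor c0 cA.
have P'f : fps_eval P' f = 0 by apply: (scale_ann v); rewrite -PE.
(* [P'] vanishes at [f], so it is not a unit; hence [v] is one, and [P'] can be traded for [P]. *)
have [|uv|uP] := irrP v%:P P'; first by rewrite mul_polyC.
  exists (v%:P^-1 * Q'); rewrite AE PE -mul_polyC mulrCA -!mulrA.
  by rewrite mulVKr.
by case/negP: (nunit _ P'f).
Qed.

Lemma minimal_polynomial_size {F : fieldType} {f : fps F}
    {P A : {poly {poly F}}} :
  minimal_polynomial f P -> A != 0 -> fps_eval A f = 0 ->
  (size P <= size A)%N /\ (sizeY P <= sizeY A)%N.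
Proof.
move=> minP A0 /(minimal_polynomial_dvd minP)[B AE].
split; first by apply: dvdp_leq A0 _; rewrite AE dvdp_mull.
rewrite !sizeYE; apply: dvdp_leq; first by rewrite swapXY_eq0.
by rewrite AE rmorphM dvdp_mull.
Qed.

(** * Annihilating polynomials from the degree of the extension *)

Local Notation "x %:F" := (FracField.tofrac x).

Lemma ratfun_laurent_tofrac {F : fieldType} (u : {poly F}) :
  ratfun_laurent (u%:F) = (fps_of_poly u)%:F.
Proof.
have -> : u%:F = u%:F / 1%:F :> {fraction {poly F}} by rewrite tofrac1 divr1.
by rewrite ratfun_laurentE ?oner_eq0 // rmorph1 tofrac1 divr1.
Qed.

Lemma ratfun_adjoin_exp {F : fieldType} (f : fps F) (k : nat) :
  ratfun_adjoin f (f%:F ^+ k).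
Proof.
move=> S [S1 _ Sdiv] _ Sf; elim: k => [|k IH]; first by rewrite expr0.
(* [divring_closed] offers closure under division, so the product is written as a quotient by an
   inverse. *)
rewrite exprSr -[X in _ * X]invrK; apply/Sdiv => //.
by rewrite -div1r; apply: Sdiv.
Qed.

Lemma common_denominator {R : idomainType} {n : nat} (v : 'I_n -> {fraction R}) :
  exists2 c, c != 0 & exists u : 'I_n -> R, forall i, c%:F * v i = (u i)%:F.
Proof.
exists (\prod_i \d_(repr (v i))).
  by apply/prodf_neq0 => i _; apply: denom_ratioP.
exists (fun i => (\prod_(j | j != i) \d_(repr (v j))) * \n_(repr (v i))) => i.
rewrite (bigD1 i) //= !rmorphM /= {2}[v i]fracE mulrC -mulrA.
by rewrite [X in _ = X]mulrC mulKf // tofrac_eq0 denom_ratioP.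
Qed.

(** The d + 1 powers 1, ..., f^d lie in the span of d elements, so they are dependent over F(x);
    clearing denominators in the relation gives [A]. *)
Lemma alg_degree_annihilator {F : fieldType} {f : fps F} {d : nat} :
  alg_degree f d ->
  exists A, [/\ A != 0, fps_eval A f = 0 & (size A <= d.+1)%N].
Proof.
move=> [b [_ _ bspan]].
pose c (k : 'I_d.+1) := cid (bspan _ (ratfun_adjoin_exp f k)).
pose M := \matrix_(k < d.+1, i < d) sval (c k) i.
have [v v0 vM] : exists2 v : 'rV_d.+1, v != 0 & v *m M = 0.
  apply: contrapT => nv; have : row_free M.
    apply: inj_row_free => v vM; apply/eqP; apply: contrapT => /negP v0.
    by apply: nv; exists v.
  by move=> rfM; have := rank_leq_col M; rewrite (eqP rfM) ltnn.
have [e e0 [u uE]] := common_denominator (fun k => v 0 k).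
exists (\poly_(k < d.+1) u (inord k)); split; last exact: size_poly.
  apply: contraNneq v0 => u0; apply/eqP/rowP => k; rewrite mxE.
  have /eqP := congr1 (fun p : {poly {poly F}} => (p`_k)%:F) u0.
  rewrite coef_poly ltn_ord inord_val coef0 -uE tofrac0 mulf_eq0 tofrac_eq0.
  by rewrite (negPf e0) => /eqP.
apply/eqP; rewrite -tofrac_eq0 /fps_eval.
rewrite (@horner_coef_wide _ d.+1); last first.
  by rewrite (leq_trans (size_poly _ _)) ?size_poly.
rewrite rmorph_sum /=.
transitivity (ratfun_laurent e%:F * \sum_i ratfun_laurent ((v *m M) 0 i) * b i == 0).
  congr (_ == _); rewrite mulr_sumr.
  transitivity (\sum_(k < d.+1) ratfun_laurent (u k)%:F * f%:F ^+ k).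
    apply: eq_bigr => k _; rewrite coef_map coef_poly ltn_ord inord_val.
    by rewrite ratfun_laurent_tofrac rmorphM rmorphXn.
  transitivity (\sum_(k < d.+1) \sum_i
      ratfun_laurent e%:F * (ratfun_laurent (v 0 k * M k i) * b i)).
    apply: eq_bigr => k _; rewrite -uE rmorphM -mulrA; rewrite -mulr_sumr.
    congr (_ * _); rewrite (svalP (c k)) mulr_sumr; apply: eq_bigr => i _.
    by rewrite rmorphM mxE mulrA.
  rewrite exchange_big; apply: eq_bigr => i _.
  by rewrite -mulr_sumr -mulr_suml mxE rmorph_sum.
by rewrite vM big1 ?mulr0 ?eqxx // => i _; rewrite mxE rmorph0 mul0r.
Qed.

(** * Automata and the bound on the number of states *)

Lemma dfao_generates_comp {q : nat} {A : Type} {a : nat -> A} (M : dfao q A) :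
  dfao_generates M a ->
  exists2 c : nat, is_comp q a c & (c <= #|dfao_state M|)%N.
Proof.
move=> genM.
pose S n := `[< exists2 N : dfao q A, dfao_generates N a & #|dfao_state N| = n >].
have exS : exists n, S n by exists #|dfao_state M|; apply/asboolP; exists M.
case: (ex_minnP exS) => c /asboolP Sc minc; exists c; last first.
  by apply: minc; apply/asboolP; exists M.
by split=> // N genN; apply: minc; apply/asboolP; exists N.
Qed.

Section Automaton.
Variables (F : finFieldType) (f : fps F) (d h : nat) (P : {poly {poly F}}).
Hypotheses (Fq : [pchar F].-nat #|F|) (Pf : fps_eval P f = 0).
Hypotheses (sPy : (size P <= d.+1)%N) (sPx : (sizeY P <= h.+1)%N).

Local Notation q := #|F|.
Local Notation liftp := (map_poly (@fps_of_poly F)).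

(** Degree d in y, one more than sections reach, is allowed so that the initial numerator y P_y
    qualifies. *)
Definition small_bipoly (R : {poly {poly F}}) : Prop :=
  (size R <= d.+1)%N /\ (sizeY R <= h.+1)%N.

Definition bipoly_section (r : nat) (R : {poly {poly F}}) : {poly {poly F}} :=
  \poly_(j < d) poly_section q r h.+1 (R * P ^+ q.-1)`_(q * j + q.-1)%N.

(** The degree in x of R P^(q-1) is at most h + (q-1) h = q h, which is less than q (h+1). *)
Lemma sizeY_section_arg (R : {poly {poly F}}) (k : nat) :
  (sizeY R <= h.+1)%N -> (size ((R * P ^+ q.-1)`_k)%R <= q * h.+1)%N.
Proof.
move=> sR; apply: leq_trans (max_size_coefXY _ _) _.
have E : swapXY (R * P ^+ q.-1) = swapXY R * swapXY P ^+ q.-1.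
  by rewrite rmorphM rmorphXn.
rewrite sizeYE E; apply: leq_trans (size_polyMleq _ _) _.
have := size_poly_exp_leq (swapXY P) q.-1.
move: sR sPx; rewrite !sizeYE.
have := finNzRing_gt1 F; rewrite /=.
move: (size (swapXY R)) (size (swapXY P)) (size (swapXY P ^+ q.-1)) => x y z.
by case: q => // n _ /=; nia.
Qed.

Lemma fps_eval_bipoly_section (r : nat) (R : {poly {poly F}}) (g : fps F) :
  (r < q)%N -> (0 < d)%N -> small_bipoly R ->
  fps_eval P^`() f * g = fps_eval R f ->
  fps_eval P^`() f * fps_section q r g = fps_eval (bipoly_section r R) f.
Proof.
move=> rq d0 [sR sRx] eg; have q1 := finNzRing_gt1 F.
have q0 : (0 < q)%N := ltnW q1.
have [Q PE] : exists Q, liftp P = Q * ('X - f%:P).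
  by apply/factor_theorem; rewrite /root -/(fps_eval P f) Pf.
have Qf : Q.[f] = fps_eval P^`() f.
  rewrite /fps_eval -deriv_map PE derivM derivXsubC hornerD !hornerM.
  by rewrite hornerXsubC subrr mulr0 add0r hornerC mulr1.
have sQ : (size Q <= d)%N.
  have [->|Q0] := eqVneq Q 0; first by rewrite size_poly0.
  have : (size (liftp P) <= d.+1)%N by rewrite (leq_trans (size_poly _ _)).
  by rewrite PE size_Mmonic ?monicXsubC // size_XsubC addn2.
pose G := liftp R * Q ^+ q.-1.
have GE : liftp (R * P ^+ q.-1) = G * ('X - f%:P) ^+ q.-1.
  by rewrite rmorphM rmorphXn /= PE exprMn mulrA.
(* The degree in y is at most d + (q-1)(d-1) = q (d-1) + 1, below q d because q >= 2. *)
have sG : (size G <= q * d)%N.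
  apply: leq_trans (size_polyMleq _ _) _.
  have sR' : (size (liftp R) <= d.+1)%N by rewrite (leq_trans (size_poly _ _)).
  move: (size_poly_exp_leq Q q.-1) sR' sQ d0 q1; rewrite /=.
  move: (size (liftp R)) (size Q) (size (Q ^+ q.-1)) => x y z.
  by case: q => // n /=; nia.
have Aq : [pchar fps F].-nat q.
  apply: sub_in_pnat Fq => p _; rewrite !inE => /andP[-> /eqP p0] /=.
  apply/eqP; rewrite -(rmorph_nat (@fps_of_poly F)).
  by rewrite -polyC_natr p0 rmorph0.
(* Since Q(f) = e, multiplying e g = R(x,f) by e^(q-1) gives G(f); the factor e^q leaves the section
   as e. *)
have Gf : fps_eval P^`() f ^+ q * g = G.[f].
  by rewrite hornerM horner_exp Qf -{1}(prednK q0) exprSr -mulrA eg mulrC.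
rewrite -fps_section_expM // Gf.
rewrite -(horner_section _ q d f G) // -GE fps_section_sum.
rewrite /fps_eval (@horner_coef_wide _ d); last first.
  by rewrite (leq_trans (size_poly _ _)) ?size_poly.
rewrite big_mkord; apply: eq_bigr => j _.
rewrite !coef_map /= coef_poly ltn_ord fps_of_poly_section; last first.
  exact: sizeY_section_arg.
by rewrite [in RHS]mulrC -fps_section_expM // -exprM [(j * _)%N]mulnC mulrC.
Qed.

(** Row [j] lists the coefficients in x of the factor of y^j. Matrices make the states a finite type
    with q^(d(h+1)) elements. *)
Definition decode (M : 'M[F]_(d, h.+1)) : {poly {poly F}} :=
  \sum_(j < d) rVpoly (row j M) *: 'X^j.

Definition encode (R : {poly {poly F}}) : 'M[F]_(d, h.+1) :=
  \matrix_(j < d) poly_rV R`_j.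

Lemma coef_decode (M : 'M[F]_(d, h.+1)) (j : 'I_d) :
  (decode M)`_j = rVpoly (row j M).
Proof.
rewrite coef_sum (bigD1 j) //= coefZ coefXn eqxx mulr1 big1 ?addr0 // => k kj.
by rewrite coefZ coefXn eq_sym -[(_ == _ :> nat)]/(k == j) (negPf kj) mulr0.
Qed.

Lemma size_decode (M : 'M[F]_(d, h.+1)) : (size (decode M) <= d)%N.
Proof.
apply: leq_trans (size_sum _ _ _) _; apply/bigmax_leqP => j _.
by rewrite (leq_trans (size_scale_leq _ _)) // size_polyXn.
Qed.

Lemma small_decode (M : 'M[F]_(d, h.+1)) : small_bipoly (decode M).
Proof.
split; first exact: leq_trans (size_decode M) _.
apply/bigmax_leqP => i _; have [lt|ge] := ltnP i d.
  by rewrite (coef_decode M (Ordinal lt)) size_poly.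
by rewrite nth_default ?size_poly0 // (leq_trans (size_decode M)).
Qed.

Lemma encodeK (R : {poly {poly F}}) :
  (size R <= d)%N -> (sizeY R <= h.+1)%N -> decode (encode R) = R.
Proof.
move=> sR sRx; apply/polyP => i; have [lt|ge] := ltnP i d; last first.
  by rewrite !nth_default // (leq_trans _ ge) // size_decode.
rewrite (coef_decode _ (Ordinal lt)) rowK poly_rV_K //.
exact: leq_trans (max_size_coefXY _ _) sRx.
Qed.

(* None is the initial state f = (y P_y)(x,f) / P_y(x,f); the state M stands for
   (decode M)(x,f) / P_y(x,f). *)
Definition numerator (s : option 'M[F]_(d, h.+1)) : {poly {poly F}} :=
  if s is Some M then decode M else 'X * P^`().

(** When e(0) is nonzero, the output is the constant term of the series that the state stands
    for. *)
Definition section_dfao : dfao q F := {|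
  dfao_start := None;
  dfao_step := fun s r => Some (encode (bipoly_section r (numerator s)));
  dfao_out := fun s => fps_coef (fps_eval (numerator s) f) 0%N
                       / fps_coef (fps_eval P^`() f) 0%N |}.

Lemma small_numerator s : small_bipoly (numerator s).
Proof.
case: s => [M|] /=; first exact: small_decode.
split.
  rewrite mulrC; have [->|n0] := eqVneq P^`() 0; first by rewrite mul0r size_poly0.
  have P0 : P != 0 by apply: contraNneq n0 => ->; rewrite deriv0.
  by rewrite size_mulX // (leq_trans (lt_size_deriv P0)).
rewrite mulrC sizeY_mulX; apply/bigmax_leqP => i _.
rewrite coef_deriv -scaler_nat (leq_trans (size_scale_leq _ _)) //.
exact: leq_trans (max_size_coefXY _ _) sPx.
Qed.

Lemma section_dfao_generates : (0 < d)%N ->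
  fps_coef (fps_eval P^`() f) 0%N != 0 ->
  dfao_generates section_dfao (fps_coef f).
Proof.
move=> d0 e0 w.
(* The induction on the word needs an arbitrary state [s] and the series [g] it represents. *)
suff gen g s : fps_eval P^`() f * g = fps_eval (numerator s) f ->
    dfao_out (foldl (@dfao_step _ _ section_dfao) s w)
    = fps_coef g (lsd_value w).
  apply: gen.
  by rewrite /= fps_evalM /fps_eval map_polyX hornerX mulrC.
elim: w g s => [|r w IH] g s /= eg.
  apply: (canLR (mulfK e0)); rewrite -eg /= big_ord_recl big_ord0 addr0.
  exact: mulrC.
(* Reading the digit [r] replaces [g] by its section, matching the value q n + r of a word with
   first digit r. *)
rewrite addnC; apply: (IH (fps_section q r g)) => /=.
rewrite encodeK ?size_poly //; last first.
  apply/bigmax_leqP => i _; rewrite coef_poly.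
  by case: ltnP => _; rewrite ?size_poly ?size_poly0.
exact: fps_eval_bipoly_section (ltn_ord r) d0 (small_numerator s) eg.
Qed.

End Automaton.

Theorem theorem3p1 (p m q : nat) (F : finFieldType) (f : fps F) (d h : nat)
    (P : {poly {poly F}})
    (hp : prime p) (hm : (0 < m)%N) (hq : q = (p ^ m)%N) (hF : #|F| = q)
    (hf0 : fps_coef f 0%N = 0)
    (halg : algebraicOver (@ratfun_laurent F) (FracField.tofrac f))
    (hd : alg_degree f d) (hh : alg_height f h)
    (hP : minimal_polynomial f P)
    (hder : P^`().[0].[0] != 0) :
  exists2 c : nat, is_comp q (fps_coef f) c
                 & (c <= 1 + q ^ ((h + 1) * d))%N.
Proof.
have Fq : [pchar F].-nat #|F| by apply: (finField_pnat hp); rewrite hF hq.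
have Pf := hP.2.
have sPy : (size P <= d.+1)%N.
  have [A [A0 Af sA]] := alg_degree_annihilator hd.
  exact: leq_trans (minimal_polynomial_size hP A0 Af).1 sA.
have sPx : (sizeY P <= h.+1)%N.
  have [[A [A0 Af sA]] _] := hh.
  apply: leq_trans (minimal_polynomial_size hP A0 Af).2 _.
  by rewrite -sA /degx leqSpred.
have e0 : fps_coef (fps_eval P^`() f) 0%N != 0.
  (* As f(0) = 0, putting x = 0 in A(x,f) gives A(0,0). *)
  have eval0 (A : {poly {poly F}}) : fps_coef (fps_eval A f) 0%N = A.[0].[0].
    elim/poly_ind: A => [|A c IH].
      by rewrite /fps_eval rmorph0 !horner0.
    rewrite hornerMXaddC mulr0 add0r horner_coef0.
    rewrite /fps_eval rmorphD rmorphM /= map_polyX map_polyC hornerMXaddC /=.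
    by rewrite big_ord_recl big_ord0 hf0 mulr0 !add0r.
  by rewrite eval0.
have d0 : (0 < d)%N.
  (* If d were 0, [P] would be constant in y and P_y would vanish. *)
  case: d sPy {hd} => // sP1; move: hder.
  by rewrite [P]size1_polyC // derivC !horner0 eqxx.
have gen := section_dfao_generates _ f d h P Fq Pf sPy sPx d0 e0.
have [c] := dfao_generates_comp _ gen.
(* The summand 1 in the bound counts the initial state [None]. *)
rewrite /= card_option card_mx hF => cq cle; exists c => //.
by rewrite add1n addn1 mulnC.
Qed.
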